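(* Let $\mathscr{D}_j$ be a double join matrix, that is, a block matrix $$\mathscr{D}_j=\begin{pmatrix} A & B & cJ_{p\times r} & \mathbf{0}_{p\times s}\\ B^T & C & \mathbf{0}_{q\times r} & cJ_{q\times s}\\ cJ_{r\times p} & \mathbf{0}_{r\times q} & D & \mathbf{0}_{r\times s}\\ \mathbf{0}_{s\times p} & cJ_{s\times q} & \mathbf{0}_{s\times r} & E\end{pmatrix}$$ satisfying conditions (i)–(iv) of the definition of double join matrix given in the context, with the notation $a_i,b_i,c_i,d_i,e_i$ introduced there. Then the spectrum of $\mathscr{D}_j$ consists of: (1) the eigenvalues $\lambda=d_i$ for $i=2,3,\ldots,r$; (2) the eigenvalues $\lambda=e_i$ for $i=2,3,\ldots,s$; (3) the eigenvalues $\lambda_{\pm}=\dfrac{a_i+c_i\pm\sqrt{(a_i-c_i)^2+4b_i^2}}{2}$ for $i=2,3,\ldots,p$; (4) the eigenvalues $\lambda=c_j$ for $j=p+1,p+2,\ldots,q$; (5) the remaining four eigenvalues, given by the roots of the equation $$\begin{aligned}&\lambda^4-(e_1+c_1+a_1+d_1)\lambda^3+\bigl(e_1c_1-qs+(a_1+d_1)(e_1+c_1)+a_1d_1-pr-b_1^2\bigr)\lambda^2\\&+\bigl((d_1+e_1)b_1^2-(a_1+d_1)(e_1c_1-qs)-(a_1d_1-pr)(e_1+c_1)\bigr)\lambda\\&+(a_1d_1-pr)(e_1c_1-qs)-d_1e_1b_1^2=0.\end{aligned}$$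
   Context: Here $A,C,D,E$ are real matrices of order $p,q,r,s$, respectively, $B$ is a $p\times q$ matrix with $p<q$, and $c=\pm1$. $J_{p\times r}$ denotes the $p\times r$ matrix with every entry equal to 1, $\mathbf{0}_{p\times s}$ the $p\times s$ zero matrix, $\mathbf{0}_n$ the zero column vector of order $n$, and $\mathbf{1}_n$ the column vector of order $n$ with every entry 1. The spectrum of a matrix is the set of all its eigenvalues. The matrix $\mathscr{D}_j$ (of order $p+q+r+s$) of the displayed block form is called a double join matrix if it satisfies the following four conditions. (i) If $\mathbf{X}_i$ and $\mathbf{Y}_i$ are the singular vector pairs of $B$ corresponding to the singular values $b_i$ for $i=1,2,\ldots,p$, then $\mathbf{X}_i$ and $\mathbf{Y}_i$ are the orthogonal unit eigenvectors of $A$ and $C$. Equivalently, $B\mathbf{Y}_i=b_i\mathbf{X}_i$ and $B^T\mathbf{X}_i=b_i\mathbf{Y}_i$ for $i=1,2,\ldots,p$ imply $A\mathbf{X}_i=a_i\mathbf{X}_i$ and $C\mathbf{Y}_i=c_i\mathbf{Y}_i$, where $a_i$ and $c_i$ are eigenvalues of $A$ and $C$, respectively. (ii) $\mathbf{X}_1=\frac{1}{\sqrt p}\mathbf{1}_p$ and $\mathbf{Y}_1=\frac{1}{\sqrt q}\mathbf{1}_q$ are the unit eigenvectors of $A$ and $C$ corresponding to the eigenvalues $a_1$ and $c_1$, respectively. (iii) If $B\mathbf{Y}_j=\mathbf{0}_p$ for $j=p+1,p+2,\ldots,q$, then $\mathbf{Y}_j$ are the orthogonal eigenvectors of $C$,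 that is, $C\mathbf{Y}_j=c_j\mathbf{Y}_j$ for $j=p+1,p+2,\ldots,q$, where $c_j$ are eigenvalues of $C$. (iv) $\mathbf{Z}_1=\frac{1}{\sqrt r}\mathbf{1}_r$ and $\mathbf{W}_1=\frac{1}{\sqrt s}\mathbf{1}_s$ are the unit eigenvectors of $D$ and $E$ corresponding to the eigenvalues $d_1$ and $e_1$, respectively. The eigenvalues of $D$ are denoted $d_1,d_2,\ldots,d_r$ and those of $E$ are denoted $e_1,e_2,\ldots,e_s$, with $d_1,e_1$ as in (iv). *)

(* Defs.v *)
(* The real numbers are any real closed field R, and R[i] is
   its algebraic closure.  Families of vectors and scalars are functions on nat
   of which only the values at the indices 1, 2, ... (up to the relevant order)
   are constrained. *)
From HB Require Import structures.
From mathcomp Require Import all_boot all_order all_algebra.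
From mathcomp Require Export complex.
Set Implicit Arguments.
Unset Strict Implicit.
Unset Printing Implicit Defensive.
Import Order.TTheory GRing.Theory Num.Theory.
Local Open Scope ring_scope.
Local Open Scope complex_scope.

Section DoubleJoin.
Variable R : rcfType.

Definition cplx_mx m n (M : 'M[R]_(m, n)) : 'M[R[i]]_(m, n) :=
  map_mx (real_complex R) M.

Definition cplx_poly (P : {poly R}) : {poly R[i]} :=
  map_poly (real_complex R) P.

(* l lists the complex eigenvalues of M, with algebraic multiplicity. *)
Definition eigenvalue_list n (M : 'M[R]_n) (l : seq R[i]) : Prop :=
  char_poly (cplx_mx M) = \prod_(x <- l) ('X - x%:P).

Lemma eigenvalue_listP n (M : 'M[R]_n) (l : seq R[i]) :
  eigenvalue_list M l -> eigenvalue (cplx_mx M) =i l.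
Proof.
by move=> Ml x; rewrite -topredE /= eigenvalue_root_char Ml root_prod_XsubC.
Qed.

Definition eigenvector n (M : 'M[R]_n) (x : R) (v : 'cV[R]_n) : Prop :=
  v != 0 /\ M *m v = x *: v.

Definition dot n (u v : 'cV[R]_n) : R := (u^T *m v) 0 0.

Definition unit_ones n : 'cV[R]_n := (Num.sqrt n%:R)^-1 *: const_mx 1.

Definition double_join_mx p q r s (eps : R)
    (A : 'M[R]_p) (B : 'M[R]_(p, q)) (C : 'M[R]_q) (D : 'M[R]_r) (E : 'M[R]_s)
    : 'M[R]_((p + q) + (r + s)) :=
  block_mx
    (block_mx A B B^T C)
    (block_mx (eps *: const_mx 1) 0 0 (eps *: const_mx 1))
    (block_mx (eps *: const_mx 1) 0 0 (eps *: const_mx 1))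
    (block_mx D 0 0 E).

(* A system of singular vectors of B, with p <= q: the pairs (X_i, Y_i) for
   1 <= i <= p, completed by an orthogonal basis Y_(p+1), ..., Y_q of the
   remaining part of the kernel of B.  The singular values b_i are in no
   particular order and may vanish. *)
Record singular_system p q (B : 'M[R]_(p, q))
    (X : nat -> 'cV[R]_p) (Y : nat -> 'cV[R]_q) (b : nat -> R) : Prop := {
  sv_ge0 : forall i, (1 <= i <= p)%N -> 0 <= b i;
  sv_right : forall i, (1 <= i <= p)%N -> B *m Y i = b i *: X i;
  sv_left : forall i, (1 <= i <= p)%N -> B^T *m X i = b i *: Y i;
  sv_kernel : forall j, (p < j <= q)%N -> B *m Y j = 0;
  sv_unitX : forall i, (1 <= i <= p)%N -> dot (X i) (X i) = 1;
  sv_unitY : forall i, (1 <= i <= p)%N -> dot (Y i) (Y i) = 1;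
  sv_neq0Y : forall j, (p < j <= q)%N -> Y j != 0;
  sv_orthoX : forall i j, (1 <= i <= p)%N -> (1 <= j <= p)%N -> i != j ->
    dot (X i) (X j) = 0;
  sv_orthoY : forall i j, (1 <= i <= q)%N -> (1 <= j <= q)%N -> i != j ->
    dot (Y i) (Y j) = 0
}.

(* The requirement that the all-ones vectors be eigenvectors, hence nonzero,
   forces all four orders p, q, r, s to be positive. *)
Record double_join p q r s
    (A : 'M[R]_p) (B : 'M[R]_(p, q)) (C : 'M[R]_q) (D : 'M[R]_r) (E : 'M[R]_s)
    (X : nat -> 'cV[R]_p) (Y : nat -> 'cV[R]_q)
    (a b c : nat -> R) (d1 e1 : R) : Prop := {
  dj_svd : singular_system B X Y b;
  dj_eigA : forall i, (1 <= i <= p)%N -> eigenvector A (a i) (X i);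
  dj_eigC : forall i, (1 <= i <= p)%N -> eigenvector C (c i) (Y i);
  dj_X1 : X 1%N = unit_ones p;
  dj_Y1 : Y 1%N = unit_ones q;
  dj_eigA1 : eigenvector A (a 1%N) (unit_ones p);
  dj_eigC1 : eigenvector C (c 1%N) (unit_ones q);
  dj_eigC_kernel : forall j, (p < j <= q)%N -> eigenvector C (c j) (Y j);
  dj_eigD : eigenvector D d1 (unit_ones r);
  dj_eigE : eigenvector E e1 (unit_ones s)
}.

Definition lambda_plus (a b c : R) : R :=
  (a + c + Num.sqrt ((a - c) ^+ 2 + 4 * b ^+ 2)) / 2.

Definition lambda_minus (a b c : R) : R :=
  (a + c - Num.sqrt ((a - c) ^+ 2 + 4 * b ^+ 2)) / 2.

Definition quartic (p q r s : nat) (a1 b1 c1 d1 e1 : R) : {poly R} :=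
  let pr := p%:R * r%:R in
  let qs := q%:R * s%:R in
  'X^4
  - (e1 + c1 + a1 + d1) *: 'X^3
  + (e1 * c1 - qs + (a1 + d1) * (e1 + c1) + a1 * d1 - pr - b1 ^+ 2) *: 'X^2
  + ((d1 + e1) * b1 ^+ 2 - (a1 + d1) * (e1 * c1 - qs)
     - (a1 * d1 - pr) * (e1 + c1)) *: 'X
  + ((a1 * d1 - pr) * (e1 * c1 - qs) - d1 * e1 * b1 ^+ 2)%:P.

End DoubleJoin.

(* Main.v *)
(* For generic x, eliminating D and E from det(x I - M) by a Schur complement
   only uses that the all-ones vectors are eigenvectors of D and E:
   (x I - D)^-1 1 = (x - d1)^-1 1, so D and E need be neither symmetric nor
   diagonalizable.  What remains is a perturbation of the matrix [A B; B^T C] by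
   multiples of the all-ones matrices, i.e. of the projections onto X_1 and Y_1,
   which the bases X_i and Y_j bring to a block matrix with diagonal blocks.
   A second Schur complement factors its determinant into 2 x 2 determinants,
   the first of which, times (x - d1)(x - e1), is the quartic.  The resulting
   identity, valid for all but finitely many x, is one of polynomials. *)
Require Import Defs.
From HB Require Import structures.
From mathcomp Require Import all_boot all_order all_algebra.
From mathcomp Require Import complex.
From mathcomp Require Import ring.
Set Implicit Arguments.
Unset Strict Implicit.
Unset Printing Implicit Defensive.
Import Order.TTheory GRing.Theory Num.Theory.
Local Open Scope ring_scope.
Local Open Scope complex_scope.

(** * Evaluation of polynomials *)

Lemma horner_char_poly (F : comNzRingType) n (M : 'M[F]_n) (x : F) :
  (char_poly M).[x] = \det (x%:M - M).
Proof.
rewrite -horner_evalE -det_map_mx; congr (\det _).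
by apply/matrixP=> i j; rewrite !mxE /= /horner_eval !hornerE hornerMn hornerX.
Qed.

(** The product [N * (P - Q)] vanishes at every point, in particular at the distinct numbers 0, 1,
    2, ..., as many of them as its size; hence it is zero and [N] cancels. The zeros of [N] stand
    for the exceptional points of a generic identity. *)
Lemma horner_ext (F : numDomainType) (P Q N : {poly F}) :
  N != 0 -> (forall x, N.[x] != 0 -> P.[x] = Q.[x]) -> P = Q.
Proof.
move=> N0 PQ; apply/eqP; rewrite -subr_eq0.
suff /eqP: N * (P - Q) = 0 by rewrite mulf_eq0 (negPf N0).
pose rs : seq F := [seq i%:R | i <- iota 0 (size (N * (P - Q)))].
apply: (@roots_geq_poly_eq0 _ _ rs); last by rewrite size_map size_iota.
- apply/allP=> x _; rewrite rootE hornerM mulf_eq0.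
  have [//|/PQ PQx] := eqVneq N.[x] 0.
  by rewrite hornerD hornerN PQx subrr eqxx.
- by rewrite /rs map_inj_uniq ?iota_uniq //; apply: mulrIn; rewrite oner_eq0.
Qed.

(** * Schur complements *)

(** Here [W] plays the role of [D^-1 C]: right multiplication by a unitriangular matrix clears the
    lower left block. Asking for a solution of a linear system instead of an inverse allows [D] to
    be singular. *)
Lemma det_block_solvel (F : comPzRingType) m n (A : 'M[F]_m) (B : 'M_(m, n))
    (C : 'M_(n, m)) (D : 'M_n) (W : 'M_(n, m)) :
  D *m W = C -> \det (block_mx A B C D) = \det (A - B *m W) * \det D.
Proof.
move=> DW; rewrite -(det_ublock _ B).
have <- : block_mx A B C D *m block_mx 1%:M 0 (- W) 1%:M
    = block_mx (A - B *m W) B 0 D.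
  by rewrite mulmx_block !mulmx1 !mulmx0 !mulmxN DW subrr !add0r.
by rewrite det_mulmx det_lblock !det1 !mulr1.
Qed.

Lemma det_block_solver (F : comPzRingType) m n (A : 'M[F]_m) (B : 'M_(m, n))
    (C : 'M_(n, m)) (D : 'M_n) (W : 'M_(m, n)) :
  A *m W = B -> \det (block_mx A B C D) = \det A * \det (D - C *m W).
Proof.
move=> AW; rewrite -(det_lblock _ C).
have <- : block_mx A B C D *m block_mx 1%:M (- W) 0 1%:M
    = block_mx A 0 C (D - C *m W).
  by rewrite mulmx_block !mulmx1 !mulmx0 !mulmxN AW !addr0 addNr addrC.
by rewrite det_mulmx det_ublock !det1 !mulr1.
Qed.

(** * Matrices built from indexed families *)

(** Families are indexed from 1 but ordinals from 0, hence the shift by one here and in the next two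
    definitions. *)
Definition diag_of (F : pzRingType) n (f : nat -> F) : 'M[F]_n :=
  diag_mx (\row_j f j.+1).

Definition pdiag_of (F : pzRingType) m n (f : nat -> F) : 'M[F]_(m, n) :=
  \matrix_(i, j) if i == j :> nat then f i.+1 else 0.

Definition cols_of (F : pzRingType) m n (V : nat -> 'cV[F]_m) : 'M[F]_(m, n) :=
  \matrix_(i, j) V j.+1 i 0.

Lemma det_diag_of (F : comPzRingType) n (f : nat -> F) :
  \det (diag_of n f) = \prod_(1 <= i < n.+1) f i.
Proof.
rewrite det_diag big_add1 big_mkord.
by apply: eq_bigr => i _; rewrite mxE.
Qed.

Lemma mul_cols_of (F : pzRingType) l m n (M : 'M[F]_(l, m)) V :
  M *m cols_of n V = cols_of n (fun j => M *m V j).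
Proof.
by apply/matrixP=> i j; rewrite !mxE; apply: eq_bigr => k _; rewrite !mxE.
Qed.

Lemma mul_cols_of_diag (F : comPzRingType) m n (M : 'M[F]_m) V (f : nat -> F) :
    (forall j, (1 <= j <= n)%N -> M *m V j = f j *: V j) ->
  M *m cols_of n V = cols_of n V *m diag_of n f.
Proof.
move=> eigV; rewrite mul_cols_of mul_mx_diag.
by apply/matrixP=> i j; rewrite [LHS]mxE eigV ?ltn_ord // !mxE mulrC.
Qed.

(** A column of [pdiag_of] has at most one nonzero entry, and is zero past the [k]-th. The case
    [k < l] serves for [B] and its kernel vectors, the case [l < k] for [B^T]. *)
Lemma mul_cols_of_pdiag (F : comPzRingType) m n k l (M : 'M[F]_(m, n))
    (V : nat -> 'cV[F]_n) (U : nat -> 'cV[F]_m) (f : nat -> F) :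
    (forall j, (1 <= j <= l)%N ->
      M *m V j = if (j <= k)%N then f j *: U j else 0) ->
  M *m cols_of l V = cols_of k U *m pdiag_of k l f.
Proof.
move=> MV; rewrite mul_cols_of.
apply/matrixP=> i j; rewrite [LHS]mxE MV ?ltn_ord // [RHS]mxE.
case: ifP => [jk | kj]; last first.
  rewrite !mxE big1 // => t _; rewrite !mxE.
  by case: eqP => [tj | _]; [rewrite -tj ltn_ord in kj | rewrite mulr0].
rewrite (bigD1 (Ordinal jk)) //= !mxE eqxx big1 => [|t]; first by rewrite addr0 mulrC.
by rewrite -val_eqE /= !mxE => /negPf ->; rewrite mulr0.
Qed.

(** By orthogonality the Gram matrix is diagonal, and its entries are squared norms of nonzero
    vectors. *)
Lemma det_cols_of_neq0 (R : realDomainType) n (V : nat -> 'cV[R]_n) :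
    (forall i, (1 <= i <= n)%N -> V i != 0) ->
    (forall i j, (1 <= i <= n)%N -> (1 <= j <= n)%N -> i != j ->
      ((V i)^T *m V j) 0 0 = 0) ->
  \det (cols_of n V) != 0.
Proof.
move=> V0 VV; pose g i := ((V i)^T *m V i) 0 0.
have gram : (cols_of n V)^T *m cols_of n V = diag_of n g.
  apply/matrixP=> i j.
  transitivity (((V i.+1)^T *m V j.+1) 0 0).
    by rewrite !mxE; apply: eq_bigr => k _; rewrite !mxE.
  rewrite [RHS]mxE [X in X *+ _]mxE; case: eqVneq => [-> //| ij] /=.
  by rewrite VV ?ltn_ord.
have : \det (diag_of n g) != 0.
  rewrite det_diag_of prodf_seq_neq0; apply/allP=> i.
  rewrite mem_index_iota ltnS => /V0; apply: contraNN; rewrite /g mxE => /eqP.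
  under eq_bigr do rewrite mxE -expr2.
  move/psumr_eq0P => vi0; apply/eqP/matrixP=> k l; rewrite ord1 mxE.
  by apply/eqP; rewrite -sqrf_eq0; apply/eqP/vi0 => // t _; apply: sqr_ge0.
by rewrite -gram det_mulmx mulf_eq0 negb_or => /andP[].
Qed.

(** The Schur complement of [diag_of p f] is again diagonal, with entries [g j - b j ^+ 2 / f j] for
    [j <= p] and [g j] beyond; the factors [f i] clear the denominators. *)
Lemma det_block_pdiag (F : fieldType) p q (f g b : nat -> F) :
    (p <= q)%N -> (forall i, (1 <= i <= p)%N -> f i != 0) ->
  \det (block_mx (diag_of p f) (- pdiag_of p q b)
                 (- (pdiag_of p q b)^T) (diag_of q g))
  = \prod_(1 <= i < p.+1) (f i * g i - b i ^+ 2)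
    * \prod_(p.+1 <= j < q.+1) g j.
Proof.
move=> pq f0.
rewrite (@det_block_solver _ _ _ _ _ _ _ (- pdiag_of p q (fun i => b i / f i)));
  last first.
  rewrite mulmxN mul_diag_mx; congr (- _); apply/matrixP=> i j.
  by rewrite !mxE; case: eqP; rewrite ?mulr0 // mulrC mulfVK // f0 ?ltn_ord.
rewrite mulmxN mulNmx opprK.
have -> : (pdiag_of p q b)^T *m pdiag_of p q (fun i => b i / f i)
    = diag_of q (fun j => if (j <= p)%N then b j ^+ 2 / f j else 0).
  apply/matrixP=> i j; rewrite !mxE.
  have [ip | pi] := ltnP i p.
    rewrite (bigD1 (Ordinal ip)) //= !mxE eqxx big1 ?addr0 => [|t].
      rewrite -val_eqE /=; case: eqP => [->|_] /=; last by rewrite mulr0.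
      by rewrite mulrA -expr2.
    by rewrite -val_eqE /= !mxE => /negPf ->; rewrite mul0r.
  rewrite mul0rn big1 // => t _; rewrite !mxE.
  by case: eqP => [ti|_]; [rewrite -ti leqNgt ltn_ord in pi | rewrite mul0r].
rewrite -[_ - _]/(_ + _) -raddfN -raddfD /=.
set u := (X in diag_mx X).
have -> : diag_mx u
    = diag_of q (fun j => g j - if (j <= p)%N then b j ^+ 2 / f j else 0).
  by congr diag_mx; apply/rowP=> j; rewrite !mxE.
rewrite !det_diag_of (@big_cat_nat _ _ _ p.+1 1 q.+1) //= mulrA; congr (_ * _).
  rewrite -big_split /=; apply: eq_big_nat => i ip.
  by rewrite (_ : (i <= p)%N) ?mulrBr 1?mulrCA ?mulfV ?mulr1 ?f0 //; case/andP: ip.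
apply: eq_big_nat => j /andP[pj _]; by rewrite leqNgt pj subr0.
Qed.

Lemma tr_pdiag_of (F : pzRingType) m n (f : nat -> F) :
  (pdiag_of m n f)^T = pdiag_of n m f.
Proof.
by apply/matrixP=> i j; rewrite !mxE eq_sym; case: eqP => // ->.
Qed.

Lemma ones_mul_ones (F : pzSemiRingType) l m n :
  (const_mx 1 : 'M[F]_(l, m)) *m (const_mx 1 : 'M_(m, n)) = m%:R *: const_mx 1.
Proof.
apply/matrixP=> i j; rewrite !mxE mulr1.
under eq_bigr do rewrite !mxE mulr1.
by rewrite sumr_const card_ord.
Qed.

(** * All-ones vectors, the quartic and the quadratic factors *)

Section DoubleJoinSpectrum.
Variable R : rcfType.
Implicit Types (m n p q r s : nat).

Lemma unit_onesK n : (0 < n)%N ->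
  const_mx 1 = Num.sqrt n%:R *: unit_ones R n.
Proof.
by move=> n0; rewrite scalerA mulfV ?scale1r // gt_eqF // sqrtr_gt0 ltr0n.
Qed.

Lemma eigenvector_unit_ones_gt0 n (M : 'M[R]_n) x :
  eigenvector M x (unit_ones R n) -> (0 < n)%N.
Proof.
by case: n M => // M [/eqP[]]; apply/matrixP=> -[].
Qed.

(** The matrix of ones is a column of ones times a row of ones, and the eigenvalue equation applies
    to the left factor. *)
Lemma mul_ones_eigenvector m n (M : 'M[R]_n) x :
  eigenvector M x (unit_ones R n) ->
  M *m const_mx 1 = x *: const_mx 1 :> 'M_(n, m).
Proof.
move=> Mx; have n0 := eigenvector_unit_ones_gt0 Mx.
have J1 : const_mx 1 = (const_mx 1 : 'cV_n) *m (const_mx 1 : 'rV_m) :> 'M[R]_(n, m).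
  by rewrite ones_mul_ones scale1r.
by rewrite J1 mulmxA (unit_onesK n0) -scalemxAr (proj2 Mx) !scalemxAl scalerA
           mulrC -scalerA.
Qed.

(** The square matrix of ones is [n] times the orthogonal projection onto the line of
    [unit_ones]. *)
Lemma ones_mulE n (v : 'cV[R]_n) : (0 < n)%N ->
  (const_mx 1 : 'M_n) *m v = (n%:R * dot (unit_ones R n) v) *: unit_ones R n.
Proof.
move=> n0; have -> : const_mx 1 = const_mx 1 *m (const_mx 1 : 'cV_n)^T :> 'M[R]_n.
  by rewrite trmx_const ones_mul_ones scale1r.
rewrite (unit_onesK n0) /dot; set w := unit_ones R n; set k := Num.sqrt _.
have -> : (k *: w)^T = k *: w^T by rewrite linearZ.
rewrite -scalemxAl -scalemxAr scalerA -expr2 sqr_sqrtr ?ler0n // -scalemxAl.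
by rewrite -mulmxA [in LHS](mx11_scalar (w^T *m v)) mul_mx_scalar scalerA.
Qed.

Lemma size_monic_quartic p q r s (a1 b1 c1 d1 e1 : R)
    (Q := quartic p q r s a1 b1 c1 d1 e1) : size Q = 5 /\ Q \is monic.
Proof.
have Q5 : (size (Q - 'X^4)%R <= 4)%N.
  apply/leq_sizeP=> j; rewrite /Q /quartic !coefE.
  by case: j => [|[|[|[|[|j]]]]] // _; rewrite /= !mulr0 !(addr0, subr0) ?subrr.
have QE : Q = 'X^4 + (Q - 'X^4) by rewrite addrC subrK.
rewrite monicE QE size_polyDl ?lead_coefDl ?lead_coefXn ?size_polyXn //.
Qed.

(** The two numbers have sum [a + c] and product [a * c - b ^+ 2], since the radicand is a sum of
    squares and so nonnegative. *)
Lemma lambda_factor (a b c : R) :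
  ('X - (lambda_plus a b c)%:P) * ('X - (lambda_minus a b c)%:P)
  = ('X - a%:P) * ('X - c%:P) - (b ^+ 2)%:P.
Proof.
rewrite /lambda_plus /lambda_minus; set t := Num.sqrt _.
have tt : t ^+ 2 = (a - c) ^+ 2 + 4 * b ^+ 2.
  by rewrite sqr_sqrtr // addr_ge0 ?sqr_ge0 // mulr_ge0 ?sqr_ge0 ?ler0n.
set u := _ / 2; set v := _ / 2.
have uv : u + v = a + c by rewrite /u /v; field.
have uv' : u * v = a * c - b ^+ 2.
  have -> : u * v = ((a + c) ^+ 2 - t ^+ 2) / 4 by rewrite /u /v; field.
  by rewrite tt; field.
have e (y z : R) : ('X - y%:P) * ('X - z%:P) = 'X^2 - (y + z)%:P * 'X + (y * z)%:P.
  by rewrite polyCD polyCM; ring.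
by rewrite !e uv uv' polyCB addrA.
Qed.

(** * The characteristic polynomial of the double join *)

Section Evaluation.
Variables (p q r s : nat) (eps : R).
Variables (A : 'M[R]_p) (B : 'M[R]_(p, q)) (C : 'M[R]_q).
Variables (D : 'M[R]_r) (E : 'M[R]_s).
Variables (X : nat -> 'cV[R]_p) (Y : nat -> 'cV[R]_q).
Variables (a b c : nat -> R) (d1 e1 : R).
Hypothesis lt_pq : (p < q)%N.
Hypothesis eps2 : eps ^+ 2 = 1.
Hypothesis dj : double_join A B C D E X Y a b c d1 e1.

Let svd := dj_svd dj.

Let p_gt0 : (0 < p)%N := eigenvector_unit_ones_gt0 (dj_eigA1 dj).

Lemma det_double_join_reduce x : x != d1 -> x != e1 ->
  \det (x%:M - double_join_mx eps A B C D E)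
  = \det (block_mx (x%:M - A - (r%:R / (x - d1)) *: const_mx 1) (- B)
                   (- B^T) (x%:M - C - (s%:R / (x - e1)) *: const_mx 1))
    * (\det (x%:M - D) * \det (x%:M - E)).
Proof.
move=> xd xe.
have mulJ n k (M : 'M[R]_n) y : x != y -> eigenvector M y (unit_ones R n) ->
    (x%:M - M) *m (eps / (x - y) *: const_mx 1) = eps *: const_mx 1 :> 'M_(n, k).
  move=> xy My; rewrite -scalemxAr mulmxBl mul_scalar_mx (mul_ones_eigenvector _ My).
  by rewrite -scalerBl scalerA divfK // subr_eq0.
rewrite /double_join_mx [x%:M]scalar_mx_block opp_block_mx add_block_mx !add0r.
(* This solution is explicit, so [x] may be an eigenvalue of [D] or [E] other than [d1] and [e1]. *)
rewrite (det_block_solvel _ _ (W := - block_mx (eps / (x - d1) *: const_mx 1) 0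
                                  0 (eps / (x - e1) *: const_mx 1))); last first.
  rewrite mulmxN; congr (- _).
  rewrite scalar_mx_block opp_block_mx add_block_mx !oppr0 !addr0 mulmx_block.
  rewrite !mulmx0 !mul0mx !addr0 !add0r !mulJ //.
    exact: (dj_eigE dj).
  exact: (dj_eigD dj).
congr (_ * _); last first.
  by rewrite scalar_mx_block opp_block_mx add_block_mx oppr0 !addr0 det_lblock.
congr (\det _).
rewrite mulmxN mulNmx opprK scalar_mx_block !opp_block_mx !add_block_mx.
rewrite mulmx_block !(mulmx0, mul0mx, addr0, add0r) opp_block_mx add_block_mx.
rewrite oppr0 !addr0 -!scalemxAl -!scalemxAr !ones_mul_ones !scalerA.
(* The sign [eps] enters only through its square. *)
have scal k y : eps * (eps / (x - y) * k) = k / (x - y).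
  by rewrite !mulrA -expr2 eps2 mul1r mulrC.
by rewrite subr0 !scal.
Qed.

(** The matrix of ones kills every [V j] orthogonal to [V 1], so the perturbation shifts only the
    first eigenvalue. *)
Lemma mul_shifted_eigenvector n (M : 'M[R]_n) (V : nat -> 'cV[R]_n) f x t j :
    V 1%N = unit_ones R n -> M *m V j = f j *: V j ->
    dot (V 1%N) (V j) = (j == 1%N)%:R -> (0 < n)%N ->
  (x%:M - M - t *: const_mx 1) *m V j
  = (x - f j - (if j == 1%N then n%:R * t else 0)) *: V j.
Proof.
move=> V1 MV dV n0; rewrite !mulmxBl mul_scalar_mx MV -scalemxAl ones_mulE //.
rewrite -V1 dV -!scalerBl scalerA.
by case: eqP => [->|_]; rewrite ?mulr1 ?mulr0 ?scale0r ?subr0 // -scalerBl mulrC.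
Qed.

(** The families [f] and [g] are the eigenvalues of the perturbed diagonal blocks on the [X i] and
    the [Y j]; nonvanishing of [f] permits the second Schur complement. *)
Lemma det_double_join_eval x (u := r%:R / (x - d1)) (v := s%:R / (x - e1))
    (f := fun i => x - a i - (if i == 1%N then p%:R * u else 0))
    (g := fun i => x - c i - (if i == 1%N then q%:R * v else 0)) :
    x != d1 -> x != e1 -> (forall i, (1 <= i <= p)%N -> f i != 0) ->
  (char_poly (double_join_mx eps A B C D E)).[x]
  = (\prod_(1 <= i < p.+1) (f i * g i - b i ^+ 2) * \prod_(p.+1 <= j < q.+1) g j)
    * ((char_poly D).[x] * (char_poly E).[x]).
Proof.
move=> xd xe f0; rewrite !horner_char_poly det_double_join_reduce //.
congr (_ * _); rewrite -/u -/v; set K := block_mx _ _ _ _.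
have detX : \det (cols_of p X) != 0.
  apply: det_cols_of_neq0 => [i ip|]; first by have [] := dj_eigA dj ip.
  exact: (sv_orthoX svd).
have detY : \det (cols_of q Y) != 0.
  apply: det_cols_of_neq0 => [i /andP[i0 iq]|]; last exact: (sv_orthoY svd).
  have [ip|pi] := leqP i p; first by have [] := dj_eigC dj (i := i); rewrite ?i0.
  by apply: (sv_neq0Y svd); rewrite pi.
have eigA : (x%:M - A - u *: const_mx 1) *m cols_of p X = cols_of p X *m diag_of p f.
  apply: mul_cols_of_diag => j jp.
  apply: mul_shifted_eigenvector => //; first exact: (dj_X1 dj).
    by have [] := dj_eigA dj jp.
  have [->|j1] := eqVneq j 1%N; first by rewrite (sv_unitX svd).
  by rewrite (sv_orthoX svd) // eq_sym.
have q_gt0 : (0 < q)%N by apply: leq_trans lt_pq.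
have eigC : (x%:M - C - v *: const_mx 1) *m cols_of q Y = cols_of q Y *m diag_of q g.
  apply: mul_cols_of_diag => j jq.
  apply: mul_shifted_eigenvector => //; first exact: (dj_Y1 dj).
    have [jp|pj] := leqP j p.
      by have [] := dj_eigC dj (i := j) => //; case/andP: jq => ->.
    by have [] := dj_eigC_kernel dj (j := j) => //; case/andP: jq => _ ->; rewrite pj.
  have [->|j1] := eqVneq j 1%N; first by rewrite (sv_unitY svd).
  by rewrite (sv_orthoY svd) // eq_sym.
have BY : B *m cols_of q Y = cols_of p X *m pdiag_of p q b.
  apply: mul_cols_of_pdiag => j /andP[j0 jq]; case: leqP => jp.
    by rewrite (sv_right svd) // j0.
  by rewrite (sv_kernel svd) // jp.
have BX : B^T *m cols_of p X = cols_of q Y *m (pdiag_of p q b)^T.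
  rewrite tr_pdiag_of; apply: mul_cols_of_pdiag => j jp.
  rewrite (sv_left svd) // (_ : (j <= q)%N) //.
  by apply: leq_trans (ltnW lt_pq); case/andP: jp.
have KP : K *m block_mx (cols_of p X) 0 0 (cols_of q Y)
    = block_mx (cols_of p X) 0 0 (cols_of q Y)
      *m block_mx (diag_of p f) (- pdiag_of p q b)
                  (- (pdiag_of p q b)^T) (diag_of q g).
  rewrite !mulmx_block !mulmx0 !mul0mx !addr0 !add0r eigA eigC.
  by rewrite !mulNmx BY BX !mulmxN.
(* The determinant of the change of basis occurs on both sides and cancels. *)
have /(congr1 determinant) := KP; rewrite !det_mulmx mulrC det_block_pdiag //.
  by rewrite (det_ublock (cols_of p X)); apply: mulfI; rewrite mulf_neq0.
exact: ltnW.
Qed.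

(** The two linear factors on the left clear the denominators [x - d1] and [x - e1]. [D] and [E]
    enter through their characteristic polynomials, as their eigenvalues may lie outside [R]. *)
Lemma char_poly_double_join :
  ('X - d1%:P) * ('X - e1%:P) * char_poly (double_join_mx eps A B C D E)
  = quartic p q r s (a 1%N) (b 1%N) (c 1%N) d1 e1
    * \prod_(2 <= i < p.+1) (('X - (a i)%:P) * ('X - (c i)%:P) - (b i ^+ 2)%:P)
    * \prod_(p.+1 <= j < q.+1) ('X - (c j)%:P)
    * (char_poly D * char_poly E).
Proof.
(* At [x], [N1] is [x - d1] times the first value of [f] in the evaluation. *)
pose N1 := ('X - (a 1%N)%:P) * ('X - d1%:P) - (p%:R * r%:R)%:P.
have N1_neq0 : N1 != 0.
  rewrite subr_eq0; apply/eqP => /(congr1 (fun P : {poly R} => size P)).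
  rewrite size_Mmonic ?polyXsubC_eq0 ?monicXsubC // !size_XsubC size_polyC.
  by case: eqP.
(* The excluded points are the poles [d1] and [e1] and the zeros of the values of [f]. *)
apply: (@horner_ext _ _ _ (('X - d1%:P) * ('X - e1%:P)
   * (N1 * \prod_(2 <= i < p.+1) ('X - (a i)%:P)))).
  rewrite !mulf_neq0 ?polyXsubC_eq0 // prodf_seq_neq0.
  by apply/allP => i _; rewrite polyXsubC_eq0.
move=> x; rewrite !hornerM !hornerXsubC !mulf_eq0 !negb_or => /andP[/andP[xd xe]].
rewrite subr_eq0 in xd; rewrite subr_eq0 in xe.
rewrite horner_prod prodf_seq_neq0 => /andP[N1x /allP ax].
have {}N1x : (x - a 1%N) * (x - d1) - p%:R * r%:R != 0.
  by move: N1x; rewrite !hornerE.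
rewrite det_double_join_eval //; last first.
  move=> i /andP[i0 ip]; case: ifP => [/eqP -> | i1].
    apply: contraNneq N1x => f0.
    suff -> : (x - a 1%N) * (x - d1) - p%:R * r%:R
      = (x - a 1%N - p%:R * (r%:R / (x - d1))) * (x - d1) by rewrite f0 mul0r.
    by field; rewrite subr_eq0.
  have := ax i; rewrite mem_index_iota hornerXsubC subr0; apply.
  by rewrite ltnS ip andbT ltn_neqAle eq_sym i1 i0.
rewrite big_ltn //= !horner_prod.
have -> : \prod_(2 <= i < p.+1)
    ((x - a i - (if i == 1%N then p%:R * (r%:R / (x - d1)) else 0))
     * (x - c i - (if i == 1%N then q%:R * (s%:R / (x - e1)) else 0)) - b i ^+ 2)
    = \prod_(2 <= i < p.+1)
        (('X - (a i)%:P) * ('X - (c i)%:P) - (b i ^+ 2)%:P).[x].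
  by apply: eq_big_nat => -[|[|i]] // _; rewrite !subr0 !hornerE.
(* As [p] is positive, index 1 lies outside this range and no shift occurs. *)
have -> : \prod_(p.+1 <= j < q.+1)
    (x - c j - (if j == 1%N then q%:R * (s%:R / (x - e1)) else 0))
    = \prod_(p.+1 <= j < q.+1) ('X - (c j)%:P).[x].
  apply: eq_big_nat => j /andP[pj _]; rewrite hornerXsubC gtn_eqF ?subr0 //.
  exact: leq_ltn_trans p_gt0 pj.
(* What remains is the factor of index 1: multiplied by [(x - d1) * (x - e1)], it is the quartic at
   [x]. *)
rewrite !mulrA; congr (_ * _ * _ * _ * _).
rewrite /quartic !(hornerD, hornerN, hornerZ, hornerXn, hornerX, hornerC).
by field; rewrite !subr_eq0 xd xe.
Qed.

End Evaluation.
End DoubleJoinSpectrum.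
Theorem theorem3 (R : rcfType) (p q r s : nat) (eps : R)
    (A : 'M[R]_p) (B : 'M[R]_(p, q)) (C : 'M[R]_q) (D : 'M[R]_r) (E : 'M[R]_s)
    (X : nat -> 'cV[R]_p) (Y : nat -> 'cV[R]_q)
    (a b c : nat -> R) (d1 e1 : R) (d e : nat -> R[i])
    (lt_pq : (p < q)%N)
    (eps1 : eps = 1 \/ eps = -1)
    (dj : double_join A B C D E X Y a b c d1 e1)
    (d_1 : d 1%N = d1%:C)
    (e_1 : e 1%N = e1%:C)
    (eigD : eigenvalue_list D [seq d i | i <- index_iota 1 r.+1])
    (eigE : eigenvalue_list E [seq e i | i <- index_iota 1 s.+1]) :
  let M := double_join_mx eps A B C D E in
  let Q := quartic p q r s (a 1%N) (b 1%N) (c 1%N) d1 e1 in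
  (forall x : R[i], eigenvalue (cplx_mx M) x <->
    (exists2 i, (2 <= i <= r)%N & x = d i) \/
    (exists2 i, (2 <= i <= s)%N & x = e i) \/
    (exists2 i, (2 <= i <= p)%N &
       x = (lambda_plus (a i) (b i) (c i))%:C \/
       x = (lambda_minus (a i) (b i) (c i))%:C) \/
    (exists2 j, (p < j <= q)%N & x = (c j)%:C) \/
    root (cplx_poly Q) x)
  /\
  (exists mu : 4.-tuple R[i],
    cplx_poly Q = \prod_(x <- mu) ('X - x%:P) /\
    eigenvalue_list M
      ([seq d i | i <- index_iota 2 r.+1] ++
       [seq e i | i <- index_iota 2 s.+1] ++
       [seq (lambda_plus (a i) (b i) (c i))%:C | i <- index_iota 2 p.+1] ++
       [seq (lambda_minus (a i) (b i) (c i))%:C | i <- index_iota 2 p.+1] ++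
       [seq (c j)%:C | j <- index_iota p.+1 q.+1] ++
       mu)).
Proof.
move=> M Q.
have eps2 : eps ^+ 2 = 1 by case: eps1 => ->; rewrite ?sqrrN expr1n.
have r_gt0 := eigenvector_unit_ones_gt0 (dj_eigD dj).
have s_gt0 := eigenvector_unit_ones_gt0 (dj_eigE dj).
(* The list with multiplicities implies the description of the spectrum as a set, by membership in
   each sublist. *)
suff [mu [Qmu Ml]] : exists mu : 4.-tuple R[i],
    cplx_poly Q = \prod_(x <- mu) ('X - x%:P) /\
    eigenvalue_list M
      ([seq d i | i <- index_iota 2 r.+1] ++
       [seq e i | i <- index_iota 2 s.+1] ++
       [seq (lambda_plus (a i) (b i) (c i))%:C | i <- index_iota 2 p.+1] ++
       [seq (lambda_minus (a i) (b i) (c i))%:C | i <- index_iota 2 p.+1] ++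
       [seq (c j)%:C | j <- index_iota p.+1 q.+1] ++ mu).
  split; last by exists mu.
  move=> x; rewrite -[eigenvalue _ x]/(x \in eigenvalue _) (eigenvalue_listP Ml).
  rewrite Qmu root_prod_XsubC !mem_cat.
  have memP (f : nat -> R[i]) m n :
      reflect (exists2 i, (m <= i <= n)%N & x = f i)
              (x \in [seq f i | i <- index_iota m n.+1]).
    apply: (iffP mapP) => -[k]; first by rewrite mem_index_iota ltnS; exists k.
    by move=> im ->; exists k; rewrite // mem_index_iota ltnS.
  split.
    case/orP=> [/memP|]; first by left.
    case/orP=> [/memP|]; first by right; left.
    case/orP=> [/memP[i ip xi]|]; first by right; right; left; exists i; auto.
    case/orP=> [/memP[i ip xi]|]; first by right; right; left; exists i; auto.
    by case/orP=> [/memP|]; right; right; right; [left | right].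
  case=> [/memP->|[/memP->|[[i ip [xi|xi]]|[/memP->|->]]]]; rewrite ?orbT //.
    suff /memP-> : exists2 i, (2 <= i <= p)%N & x = (lambda_plus (a i) (b i) (c i))%:C
      by rewrite !orbT.
    by exists i.
  suff /memP-> : exists2 i, (2 <= i <= p)%N & x = (lambda_minus (a i) (b i) (c i))%:C
    by rewrite !orbT.
  by exists i.
have [sizeQ Qmonic] := size_monic_quartic p q r s (a 1%N) (b 1%N) (c 1%N) d1 e1.
have [mu Qmu] : exists mu : 4.-tuple R[i], cplx_poly Q = \prod_(x <- mu) ('X - x%:P).
  have [mu] := closed_field_poly_normal (cplx_poly Q).
  rewrite lead_coef_map (monicP Qmonic) rmorph1 scale1r => Qmu.
  have mu4 : size mu == 4.
    by rewrite -eqSS -(size_prod_XsubC _ id) -Qmu size_map_poly sizeQ.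
  by exists (Tuple mu4).
exists mu; split=> //.
have dX : 'X - (d1%:C)%:P != 0 :> {poly R[i]} by rewrite polyXsubC_eq0.
have eX : 'X - (e1%:C)%:P != 0 :> {poly R[i]} by rewrite polyXsubC_eq0.
(* The identity over [R] carries two extra linear factors; they are restored here so that both sides
   can be compared. *)
apply: (mulfI (mulf_neq0 dX eX)).
have := congr1 (map_poly (real_complex R)) (char_poly_double_join lt_pq eps2 dj).
rewrite !rmorphM /= !map_polyXsubC !map_char_poly => ->.
rewrite -/(cplx_poly _) -/Q Qmu eigD eigE !big_cat !big_map /=.
(* Splitting off the first eigenvalues of [D] and [E], possible as [r] and [s] are positive,
   produces exactly those two factors. *)
rewrite (@big_ltn _ _ _ 1 r.+1) // d_1 (@big_ltn _ _ _ 1 s.+1) // e_1 !rmorph_prod /=.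
under [X in _ * X * _ * _]eq_bigr do rewrite -lambda_factor rmorphM /= !map_polyXsubC.
under [X in _ * _ * X * _]eq_bigr do rewrite map_polyXsubC.
rewrite big_split /=; ring.
Qed.
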